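(* Let $n\ge 1$ and let $R=(r_1,\dots,r_n)$ and $S=(s_1,\dots,s_n)$ be vectors of nonnegative integers, all of whose components are at most $n$, with $\sum_i r_i=\sum_j s_j$. Then $\mathcal{A}^{4}(R,S)\neq\emptyset$ if and only if all of the following hold: (a) $R=S$; (b) $R$ is palindromic, i.e. $r_i=r_{n+1-i}$ for all $i$; (c) if $n$ is even then every component of $R$ is even, and if $n$ is odd then $o(R)=r_{\lceil n/2\rceil}$, where $o(R)$ is the number of odd components of $R$; (d) $\check{R}\preceq\check{R}^*$, where $\check{R}=(\lfloor r_1/2\rfloor,\lfloor r_2/2\rfloor,\dots,\lfloor r_{\lfloor n/2\rfloor}/2\rfloor)$.
   Context: The dihedral group $D_4$ of the square (of order $8$) acts on $n\times n$ matrices by rotations and reflections of the square array; it is generated by the transposition $A\mapsto A^t$ and the reflection $(r_\infty A)_{i,j}=a_{i,\,n+1-j}$. $\mathcal{A}^{4}(R,S)$ is the set of $n\times n$ matrices with entries in $\{0,1\}$, with $i$th row sum $r_i$ and $j$th column sum $s_j$ for all $i,j$, that are fixed by every element of $D_4$. For a nonnegative integer vector $R$, $R^*$ denotes the conjugate of (the weakly decreasing rearrangement of) $R$ viewed as an integer partition: its $k$th component is the number of $i$ with $r_i\ge k$. For nonnegative integer vectors $U,V$, $V\preceq U$ ($V$ is majorized by $U$) means that, after rearranging both in weakly decreasing order (and padding with zeros to a common length), $u_1+\dots+u_\ell\ge v_1+\dots+v_\ell$ for all $\ell$, and the total sums of $U$ and $V$ are equal. *)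

(* Defs.v *)
From mathcomp Require Import all_boot all_fingroup all_algebra all_solvable.

Set Implicit Arguments.
Unset Strict Implicit.
Unset Printing Implicit Defensive.

Section SquareSymmetries.

Variable n : nat.

Definition cell_tr_fun (c : 'I_n * 'I_n) := (c.2, c.1).
Definition cell_refl_fun (c : 'I_n * 'I_n) := (c.1, rev_ord c.2).

Lemma cell_tr_inj : injective cell_tr_fun.
Proof. by apply: (can_inj (g := cell_tr_fun)) => -[i j]. Qed.

Lemma cell_refl_inj : injective cell_refl_fun.
Proof.
by apply: (can_inj (g := cell_refl_fun)) => -[i j];
  rewrite /cell_refl_fun /= rev_ordK.
Qed.

Definition cell_tr : {perm 'I_n * 'I_n} := perm cell_tr_inj.
Definition cell_refl : {perm 'I_n * 'I_n} := perm cell_refl_inj.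

(* The dihedral group of the square, as a group of permutations of the cells
   of the n x n array. It has order 8 for n >= 2 (see [D4_isog]); for n = 1
   it is the (trivial) image of the dihedral group. *)
Definition D4 : {group {perm 'I_n * 'I_n}} :=
  <<[set cell_tr; cell_refl]>>%G.

Lemma D4_isog : 1 < n -> D4 \isog 'D_8.
Proof.
move=> n1; pose o := Ordinal (ltnW n1).
have oN : (rev_ord o == o) = false.
  by rewrite -val_eqE /= subn_eq0 leqNgt n1.
set t := cell_tr; set r := cell_refl.
have Et c : t c = (c.2, c.1) by rewrite permE.
have Er c : r c = (c.1, rev_ord c.2) by rewrite permE.
have t2 : (t ^+ 2 = 1)%g.
  by apply/permP => -[i j]; rewrite expgS expg1 permM !Et perm1.
have r2 : (r ^+ 2 = 1)%g.
  by apply/permP => -[i j]; rewrite expgS expg1 permM !Er perm1 /= rev_ordK.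
have Etr2 c : ((t * r) ^+ 2)%g c = (rev_ord c.1, rev_ord c.2).
  by rewrite expgS expg1 !permM !(Et, Er).
have tr4 : ((t * r) ^+ 4 = 1)%g.
  apply/permP => -[i j].
  by rewrite (expgM _ 2 2) expgS expg1 permM !Etr2 /= !rev_ordK perm1.
have otr : #[(t * r)%g]%g = 4.
  rewrite (_ : 4 = 2 * 2) //; apply: orderXprime => //.
  apply: nt_prime_order; rewrite -?expgM //.
  apply/eqP => /permP /(_ (o, o)) /eqP.
  by rewrite Etr2 perm1 xpair_eqE oN.
have homD : (D4 \homg 'D_8)%g.
  rewrite (@Grp'_dihedral 4) //; apply/existsP; exists (t, r) => /=.
  by rewrite !xpair_eqE t2 r2 tr4 !eqxx joing_idl joing_idr /= eqxx.
have tD : t \in D4 by rewrite mem_gen // set21.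
have rD : r \in D4 by rewrite mem_gen // set22.
have trD : <[(t * r)%g]>%g \subset D4 by rewrite cycle_subG groupM.
rewrite isogEcard homD (@card_dihedral 4) //=.
have /dvdnP[k oD] : 4 %| #|D4| by rewrite -otr cardSg.
suff : k != 1.
  have : 0 < #|D4| by apply: cardG_gt0.
  by rewrite oD; case: k {oD} => [|[|k]] //= _ _; rewrite !mulSn addnA leq_addr.
apply/eqP => k1; rewrite k1 in oD.
have cD : abelian D4.
  by apply: (@p2group_abelian _ 2); rewrite ?/pgroup oD.
have /permP/(_ (o, o))/eqP : (t * r)%g = (r * t)%g by apply: (centsP cD).
by rewrite !permM !(Et, Er) /= xpair_eqE eq_sym oN.
Qed.

Definition D4_act (T : Type) (g : {perm 'I_n * 'I_n}) (A : 'M[T]_n) :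
    'M[T]_n :=
  \matrix_(i, j) A (g (i, j)).1 (g (i, j)).2.

Lemma D4_act_tr (T : Type) (A : 'M[T]_n) : D4_act cell_tr A = A^T%R.
Proof. by apply/matrixP => i j; rewrite !mxE permE. Qed.

Lemma D4_act_refl (T : Type) (A : 'M[T]_n) :
  D4_act cell_refl A = (\matrix_(i, j) A i (rev_ord j))%R.
Proof. by apply/matrixP => i j; rewrite !mxE permE. Qed.

Lemma D4_act_mul (T : Type) (g h : {perm 'I_n * 'I_n}) (A : 'M[T]_n) :
  D4_act (g * h)%g A = D4_act g (D4_act h A).
Proof. by apply/matrixP => i j; rewrite !mxE permM; case: (g _). Qed.

(* (0,1)-matrices are boolean matrices, [true] counting as 1 in the sums. *)
Definition A4 (R S : n.-tuple nat) : {set 'M[bool]_n} :=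
  [set A : 'M[bool]_n |
    [&& [forall i, \sum_(j < n) A i j == tnth R i],
        [forall j, \sum_(i < n) A i j == tnth S j]
      & [forall g in D4, D4_act g A == A]]].

End SquareSymmetries.

(* The parts beyond the largest component of [s], which are 0, are omitted. *)
Definition conjugate_seq (s : seq nat) : seq nat :=
  mkseq (fun k => count (fun r => k.+1 <= r) s) (\max_(r <- s) r).

(* [take l t] is all of [t] when [size t <= l], so quantifying over every [l]
   amounts to padding with zeros. *)
Definition majorized (v u : seq nat) : Prop :=
  (forall l, sumn (take l (sort geq v)) <= sumn (take l (sort geq u))) /\
  sumn v = sumn u.

Definition palindromic (n : nat) (R : n.-tuple nat) : Prop :=
  forall i : 'I_n, tnth R i = tnth R (rev_ord i).

Definition check_seq (n : nat) (R : n.-tuple nat) : seq nat :=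
  [seq r./2 | r <- take n./2 R].

(* Main.v *)
Require Import Defs.
From mathcomp Require Import all_boot all_fingroup all_algebra.
From mathcomp Require Import zify.

(* A matrix fixed by D_4 is determined by its upper left quarter, which is a
   symmetric (0,1)-matrix with row sums [r_i / 2] (rounded down), and, for odd
   [n], by its middle row and column, whose entries are the parities of the
   [r_i]. So the point is a symmetric Gale-Ryser theorem: [r] is the row sum
   vector of a symmetric (0,1)-matrix iff [r] is majorized by its conjugate.
   For the converse, majorization is turned into the inequalities
     sum_I r + sum_J r <= |I||J| + sum r
   for all index sets I and J, and these are preserved when an index [v] with
   [r v] largest is joined to itself and to the [r v - 1] next largest ones
   and then removed. *)

Set Implicit Arguments.
Unset Strict Implicit.
Unset Printing Implicit Defensive.

(** * Partial sums of the conjugate partition *)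

Lemma sumn_conjugate_take s l :
  sumn (take l (conjugate_seq s)) = \sum_(r <- s) minn r l.
Proof.
have count_lt p r : \sum_(k < p) (k.+1 <= r) = minn r p.
  elim: p => [|p IHp]; first by rewrite big_ord0 minn0.
  by rewrite big_ord_recr /= IHp; lia.
rewrite /conjugate_seq /mkseq -map_take take_iota sumnE big_map.
rewrite -{1}[minn _ _]subn0 -/(index_iota 0 _) big_mkord.
(* Double counting of the cells in the first [l] columns of the Young diagram: a row of length [r]
   has [minn r l] of them. *)
rewrite (eq_bigr (fun k : 'I__ => \sum_(r <- s) (k < r))) => [|k _]; last first.
  by rewrite -sum1_count big_mkcond /=; apply: eq_bigr => r _; case: ifP.
rewrite exchange_big /= big_seq [RHS]big_seq; apply: eq_bigr => r rs.
have : r <= \max_(r0 <- s) r0 by apply: leq_bigmax_seq.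
by rewrite count_lt; lia.
Qed.

Lemma sumn_conjugate s : sumn (conjugate_seq s) = sumn s.
Proof.
rewrite -[conjugate_seq s]take_size sumn_conjugate_take size_mkseq.
rewrite sumnE big_seq [RHS]big_seq; apply: eq_bigr => r rs.
by apply/minn_idPl; apply: leq_bigmax_seq.
Qed.

Lemma sorted_conjugate s : sorted geq (conjugate_seq s).
Proof.
apply: (homo_sorted (e := leq)); last exact: iota_sorted.
by move=> i j leij /=; apply: sub_count => r /=; lia.
Qed.

Lemma sumn_subseq_take (u s : seq nat) :
  sorted geq s -> subseq u s -> sumn u <= sumn (take (size u) s).
Proof.
elim: s u => [|x s IHs] [|y u] //= s_dec usub.
have {}IHs := IHs u (path_sorted s_dec).
have geq_tr : transitive geq by move=> a b c /= ab bc; apply: leq_trans bc ab.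
have /allP x_max := order_path_min geq_tr s_dec.
move: usub; case: eqP => [->|_] usub; first by rewrite leq_add2l IHs.
apply: leq_add; first by apply: x_max; apply: mem_subseq usub _ (mem_head _ _).
by apply: IHs; apply: subseq_trans (subseq_cons u y) usub.
Qed.

(** * Majorization by the conjugate and row sums of symmetric (0,1)-matrices *)

Section Degrees.

Variable T : finType.
Implicit Types (A B D I J : {set T}) (r f : T -> nat).

(** The conjugate has the same total and is already sorted, so only its prefix sums matter; among
    the index sets of a given size, a prefix of [e] sorted by [f] has the largest sum. *)
Lemma majorized_conjugateP (e : seq T) f : uniq e ->
  majorized (map f e) (conjugate_seq (map f e)) <->
  forall I, {subset I <= e} ->
    \sum_(i in I) f i <= \sum_(i <- e) minn (f i) #|I|.
Proof.
move=> e_uniq; rewrite /majorized sumn_conjugate.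
have sort_conj : sort geq (conjugate_seq (map f e)) = conjugate_seq (map f e).
  apply: sorted_sort; last exact: sorted_conjugate.
  by move=> a b c /= ab bc; apply: leq_trans bc ab.
rewrite sort_conj sort_map; set e' := sort _ e.
have e'_uniq : uniq e' by rewrite sort_uniq.
have e'_dec : sorted geq (map f e').
  by rewrite -sort_map; apply: sort_sorted => a b; apply: leq_total.
split=> [[maj _] I Ie|dom].
  set u := [seq x <- e' | x \in I].
  have u_sum F : \sum_(i <- u) F i = \sum_(i in I) F i.
    rewrite big_uniq ?filter_uniq //; apply: eq_bigl => x.
    rewrite mem_filter mem_sort; case: (boolP (x \in I)) => //= /Ie -> //.
  have u_size : size u = #|I| by rewrite -sum1_size u_sum sum1_card.
  have := maj #|I|; rewrite sumn_conjugate_take big_map; apply: leq_trans.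
  rewrite -u_sum -(big_map f predT id) -sumnE -u_size -(size_map f u).
  by apply: sumn_subseq_take => //; apply: map_subseq (filter_subseq _ _).
split=> // l; rewrite sumn_conjugate_take big_map -map_take.
set I := [set x in take l e'].
have t_uniq : uniq (take l e') by apply: take_uniq.
have -> : sumn (map f (take l e')) = \sum_(i in I) f i.
  by rewrite sumnE big_map big_uniq //; apply: eq_bigl => x; rewrite inE.
apply: leq_trans (dom I _) _ => [x|].
  by rewrite inE => /mem_take; rewrite mem_sort.
apply: leq_sum => i _; rewrite leq_min geq_minl (leq_trans (geq_minr _ _)) //.
by rewrite cardsE (card_uniqP t_uniq) size_take; case: ltnP.
Qed.

Lemma top_subset B r k : k <= #|B| ->
  exists2 D : {set T}, D \subset B &
    #|D| = k /\ {in D & B :\: D, forall x y, r y <= r x}.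
Proof.
elim: k => [_|k IHk ltkB].
  by exists set0; rewrite ?sub0set ?cards0 //; split=> // x y; rewrite inE.
have [D sDB [cardD topD]] := IHk (ltnW ltkB).
have [z0 Bz0] : exists z, z \in B :\: D.
  apply/set0Pn; rewrite -card_gt0 cardsD (setIidPr sDB) cardD; lia.
have [z Bz zmax] := arg_maxnP (P := mem (B :\: D)) r Bz0.
have /setDP[zB zD] := Bz.
exists (z |: D); first by rewrite subUset sub1set zB.
rewrite cardsU1 zD cardD; split=> // x y; rewrite !inE negb_or -andbA.
case/predU1P=> [->|xD] /and3P[_ yD yB]; first by apply: zmax; rewrite /= inE yD.
by apply: topD; rewrite // inE yD.
Qed.

(** Subtraction is truncated, so the last sum is the maximum of [sum_I r - |I| k] over all [I]; the
    next lemma describes the sets that attain it. *)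
Lemma threshold_excess A r k I : I \subset A ->
  \sum_(i in I) r i <= #|I| * k + \sum_(i in A) (r i - k).
Proof.
move=> sIA; rewrite -sum_nat_const (big_setID (A := A) I) /= (setIidPr sIA) addnA.
rewrite -big_split /=; apply: leq_trans (leq_addr _ _).
by apply: leq_sum => i _; lia.
Qed.

Lemma threshold_excess_eq A r k I : I \subset A ->
    {in I, forall i, k <= r i} -> {in A :\: I, forall i, r i <= k} ->
  \sum_(i in I) r i = #|I| * k + \sum_(i in A) (r i - k).
Proof.
move=> sIA geI leI; rewrite -sum_nat_const (big_setID (A := A) I) /= (setIidPr sIA).
rewrite [X in _ + (_ + X)]big1 => [|i /leI]; last by lia.
by rewrite addn0 -big_split /=; apply: eq_bigr => i /geI; lia.
Qed.

(** The cut inequalities of a bipartite flow: ones in rows [I] plus ones in columns [J] count only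
    the block [I] x [J] twice. Letting [I] and [J] vary independently allows each to be optimized
    with the other fixed. *)
Definition cut_condition A r := forall I J, I \subset A -> J \subset A ->
  \sum_(i in I) r i + \sum_(j in J) r j <= #|I| * #|J| + \sum_(i in A) r i.

(** Bound [minn (r i) #|I|] by [#|I|] on [J] and by [r i] off [J]. *)
Lemma min_cut_condition A r :
    (forall I, I \subset A ->
      \sum_(i in I) r i <= \sum_(i in A) minn (r i) #|I|) ->
  cut_condition A r.
Proof.
move=> dom I J sIA sJA; have := dom I sIA.
rewrite !(big_setID (A := A) J) /= !(setIidPr sJA).
have : \sum_(i in J) minn (r i) #|I| <= #|J| * #|I|.
  by rewrite -sum_nat_const; apply: leq_sum => i _; apply: geq_minr.
have : \sum_(i in A :\: J) minn (r i) #|I| <= \sum_(i in A :\: J) r i.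
  by apply: leq_sum => i _; apply: geq_minl.
by rewrite (mulnC #|J|); lia.
Qed.

(* A Havel-Hakimi step: [v] is joined to itself and to [D]. *)
Lemma cut_condition_step A r v D : v \in A -> {in A, forall i, r i <= r v} ->
    D \subset A :\ v -> r v = #|D|.+1 ->
    {in D & A :\ v :\: D, forall x y, r y <= r x} ->
    {in D, forall x, 0 < r x} ->
  cut_condition A r -> cut_condition (A :\ v) (fun i => r i - (i \in D)).
Proof.
move=> vA vmax sDB rv topD posD cut; set B := A :\ v; set r' := fun i => _.
have sumr (I : {set T}) :
    \sum_(i in I) r i = \sum_(i in I) r' i + #|I :&: D|.
  rewrite -sum1_card [X in _ = _ + X]big_mkcond [X in _ = X + _]big_mkcond.
  rewrite -big_split big_mkcond /=; apply: eq_bigr => i _; rewrite inE /r'.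
  case: (i \in I) => //=; case: (boolP (i \in D)) => [/posD|_] /=; lia.
have sumB : \sum_(i in A) r i = #|D|.+1 + \sum_(i in B) r i.
  by rewrite (big_setD1 v) //= rv.
have sumBr' : \sum_(i in B) r i = \sum_(i in B) r' i + #|D|.
  by rewrite sumr // (setIidPr sDB).
have sBA : B \subset A by apply: subD1set.
have ltr' i : i \in B -> r' i <= #|D|.+1.
  by move=> /(subsetP sBA)/vmax; rewrite rv /r'; lia.
(* For fixed [k = #|J|], [sum_I r' - #|I| * k] is largest when [I] consists
   of the [i] with [r' i > k], or equally of those with [r' i >= k]; one of
   these two sets contains [D] or is contained in [D]. *)
have reg k I : I \subset B -> exists2 I' : {set T}, I' \subset B &
    ((I' \subset D) || (D \subset I')) /\
    \sum_(i in I) r' i + #|I'| * k <= \sum_(i in I') r' i + #|I| * k.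
  move=> sIB; have := threshold_excess r' k sIB.
  case: (boolP [forall x in D, k <= r' x]) => [/forall_inP geD|].
    have := @threshold_excess_eq B r' k [set i in B | k <= r' i].
    set I' := [set i in B | _] => eqI' leI; have sI'B : I' \subset B.
      by apply/subsetP => i; rewrite inE => /andP[].
    exists I' => //; split; last first.
      rewrite eqI' //; first by lia.
        by move=> i; rewrite inE => /andP[].
      by move=> i; rewrite !inE => /andP[/nandP[/negP|]]; lia.
    apply/orP; right; apply/subsetP => x xD.
    by rewrite inE (subsetP sDB) ?geD.
  (* Here some [x] in [D] has [r' x < k], hence [r x <= k]; by [topD] so does every index of [B]
     outside [D], and the strict threshold set lies inside [D]. *)
  rewrite negb_forall_in => /exists_inP[x xD ltx].
  have := @threshold_excess_eq B r' k [set i in B | k < r' i].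
  set I' := [set i in B | _] => eqI' leI; have sI'B : I' \subset B.
    by apply/subsetP => i; rewrite inE => /andP[].
  exists I' => //; split; last first.
    rewrite eqI' //; first by lia.
      by move=> i; rewrite inE => /andP[_ /ltnW].
    by move=> i; rewrite !inE => /andP[/nandP[/negP|]]; lia.
  apply/orP; left; apply/subsetP => y; rewrite inE => /andP[yB lty].
  apply: contraLR lty => yD; rewrite -leqNgt /r' (negPf yD) subn0.
  have := topD x y xD; rewrite inE yD => /(_ yB).
  by move: ltx; rewrite /r' xD; lia.
have cutB I J : I \subset B -> J \subset B ->
    (I \subset D) || (D \subset I) -> (J \subset D) || (D \subset J) ->
  \sum_(i in I) r' i + \sum_(j in J) r' j <= #|I| * #|J| + \sum_(i in B) r' i.
  have cutv (K : {set T}) : K \subset B -> v |: K \subset A /\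
      #|v |: K| = #|K|.+1 /\ \sum_(i in v |: K) r i = #|D|.+1 + \sum_(i in K) r i.
    move=> sKB; have vK : v \notin K by apply: contraL isT => /(subsetP sKB); rewrite !inE eqxx.
    by rewrite subUset sub1set vA (subset_trans sKB) // cardsU1 vK big_setU1 //= rv.
  (* Each [r' i] is at most [#|D|.+1 <= #|K|], so the sum over [L] is already at most
     [#|K| * #|L|]. *)
  have large (K L : {set T}) : K \subset B -> L \subset B -> #|D| < #|K| ->
      \sum_(i in K) r' i + \sum_(j in L) r' j <= #|K| * #|L| + \sum_(i in B) r' i.
    move=> sKB sLB ltK; rewrite addnC mulnC; apply: leq_add; last first.
      by rewrite [X in _ <= X](big_setID K) /= (setIidPr sKB) leq_addr.
    by rewrite -sum_nat_const; apply: leq_sum => i /(subsetP sLB)/ltr'; lia.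
  (* The hypothesis is applied with [v] added to both sets; the reductions by 1 on [K] and [L]
     cancel the extra terms of the product exactly. *)
  have inner (K L : {set T}) : K \subset B -> L \subset B -> K \subset D -> L \subset D ->
      \sum_(i in K) r' i + \sum_(j in L) r' j <= #|K| * #|L| + \sum_(i in B) r' i.
    move=> sKB sLB sKD sLD; have [sK [cK sumK]] := cutv K sKB.
    have [sL [cL sumL]] := cutv L sLB; have := cut _ _ sK sL.
    rewrite cK cL sumK sumL sumB sumBr' !sumr // (setIidPl sKD) (setIidPl sLD).
    by rewrite mulSn mulnS; lia.
  (* Here [v] is added to the larger set [K] only. *)
  have mixed (K L : {set T}) : K \subset B -> L \subset B -> D \subset K -> L \subset D ->
      \sum_(i in K) r' i + \sum_(j in L) r' j <= #|K| * #|L| + \sum_(i in B) r' i.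
    move=> sKB sLB sDK sLD; have [sK [cK sumK]] := cutv K sKB.
    have := cut _ L sK (subset_trans sLB sBA).
    rewrite cK sumK sumB sumBr' !sumr // (setIidPr sDK) (setIidPl sLD) mulSn.
    by lia.
  move=> sIB sJB /orP[sID|sDI] /orP[sJD|sDJ]; [exact: inner| |exact: mixed|].
    by rewrite addnC mulnC mixed.
  (* Now [D] is contained in [I] and in [J]. *)
  have [ltI|leI] := ltnP #|D| #|I|; first exact: large.
  have [ltJ|leJ] := ltnP #|D| #|J|; first by rewrite addnC mulnC large.
  have /eqP eqDI : D == I by rewrite eqEcard sDI.
  have /eqP eqDJ : D == J by rewrite eqEcard sDJ.
  by apply: inner; rewrite -?eqDI -?eqDJ.
(* Optimize [I] against [#|J|], then [J] against the new [#|I'|]: each replacement only tightens the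
   inequality. *)
move=> I J sIB sJB; have [I' sI'B [regI' leI']] := reg #|J| I sIB.
have [J' sJ'B [regJ' leJ']] := reg #|I'| J sJB.
have := cutB I' J' sI'B sJ'B regI' regJ'.
by move: leI' leJ'; rewrite (mulnC #|J'|) (mulnC #|J|); lia.
Qed.

(** Induction on [#|A|] by Havel-Hakimi steps. Diagonal ones are allowed, so [v] needs just
    [(r v).-1] further neighbours. *)
Lemma cut_condition_symmetric A r : cut_condition A r ->
  exists2 M : T -> T -> bool, forall i j, M i j = M j i &
    {in A, forall i, \sum_(j in A) M i j = r i}.
Proof.
have [m] := ubnP #|A|; elim: m A r => // m IHm A r ltAm cut.
have [->|[v0 v0A]] := set_0Vmem A.
  by exists (fun _ _ => false) => // i; rewrite inE.
have [v /= vA vmax] := arg_maxnP (P := mem A) r v0A.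
have [rv0|rv_gt0] := posnP (r v).
  exists (fun _ _ => false) => // i iA; rewrite big1 //.
  by apply/esym/eqP; rewrite -leqn0 -rv0; apply: vmax.
set B := A :\ v; have cardA : #|A| = #|B|.+1 by rewrite (cardsD1 v) vA.
have cut1 J : J \subset A -> r v + \sum_(j in J) r j <= #|J| + \sum_(i in A) r i.
  by move=> sJA; have := cut [set v] J; rewrite sub1set vA big_set1 cards1 mul1n; apply.
have le_rv : (r v).-1 <= #|B| by have := cut1 A (subxx _); lia.
have [D sDB [cardD topD]] := top_subset r le_rv.
have sBA : B \subset A by apply: subD1set.
have vB : v \notin B by rewrite !inE eqxx.
have vD : v \notin D by apply: contra vB; apply: subsetP.
have posD : {in D, forall x, 0 < r x}.
  (* If [r x = 0], then [r] vanishes on [A] outside [v] and [D] too, so all of its sum lies on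
     [v |: D :\ x], a set of [(r v).-1] elements; this contradicts [cut1]. *)
  move=> x xD; rewrite lt0n; apply/eqP => rx0.
  have sJA : v |: D :\ x \subset A.
    rewrite subUset sub1set vA; apply: subset_trans (subD1set _ _) _.
    exact: subset_trans sDB sBA.
  have := cut1 _ sJA; rewrite cardsU1 !inE (negPf vD) andbF /=.
  have -> : \sum_(i in A) r i = \sum_(i in v |: D :\ x) r i.
    rewrite (big_setID (v |: D :\ x)) /= (setIidPr sJA) [X in _ + X]big1 ?addn0 //.
    move=> y; rewrite !inE negb_or negb_and negbK => /andP[/andP[yv] yDx yA].
    have [->//|yx] := eqVneq y x; rewrite (negPf yx) /= in yDx.
    by apply/eqP; rewrite -leqn0 -rx0; apply: topD => //; rewrite !inE yDx yv.
  by have := cardsD1 x D; rewrite xD; lia.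
have cutB : cut_condition B (fun i => r i - (i \in D)).
  by apply: cut_condition_step => //; rewrite cardD prednK.
have [|M Msym Msum] := IHm B _ _ cutB; first by rewrite -ltnS -cardA.
pose N i j := if i == v then j \in v |: D
              else if j == v then i \in D else M i j.
exists N => [i j|i iA].
  by rewrite /N !inE; case: (i == v); case: (j == v).
rewrite (big_setD1 v) //= {1}/N eqxx; have [->|iv] := eqVneq i v.
  rewrite setU11 (eq_bigr (fun j => nat_of_bool (j \in D))) => [|j].
    rewrite -big_mkcondr sum1_card -(prednK rv_gt0) -cardD add1n; congr _.+1.
    by apply: eq_card => j; rewrite unfold_in andb_idl // => /(subsetP sDB).
  by rewrite /N eqxx !inE => /andP[/negPf->].
rewrite (eq_bigr (fun j => nat_of_bool (M i j))) => [|j].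
  have iB : i \in B by rewrite !inE iv.
  by rewrite Msum //; case: (boolP (i \in D)) => [/posD|_]; lia.
by rewrite /N (negPf iv) !inE => /andP[/negPf->].
Qed.

(** Count the ones in rows [I] by columns: column [j] holds at most [#|I|] of them, and by symmetry
    at most [r j]. *)
Lemma symmetric_min_sum A (M : T -> T -> bool) r : (forall i j, M i j = M j i) ->
    {in A, forall i, \sum_(j in A) M i j = r i} ->
  forall I, I \subset A -> \sum_(i in I) r i <= \sum_(i in A) minn (r i) #|I|.
Proof.
move=> Msym Msum I sIA.
rewrite (eq_bigr (fun i => \sum_(j in A) M i j)) => [|i]; last first.
  by move=> /(subsetP sIA)/Msum.
rewrite exchange_big /=; apply: leq_sum => j jA; rewrite leq_min; apply/andP; split.
  rewrite -(Msum j jA) [X in _ <= X](big_setID I) /= (setIidPr sIA).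
  by under eq_bigr do rewrite Msym; apply: leq_addr.
by rewrite -sum1_card; apply: leq_sum => i _; case: (M i j).
Qed.

Lemma symmetric_majorizedP (e : seq T) r : uniq e ->
  (exists2 M : T -> T -> bool, forall i j, M i j = M j i &
    {in e, forall i, \sum_(j <- e) M i j = r i}) <->
  majorized (map r e) (conjugate_seq (map r e)).
Proof.
move=> e_uniq; rewrite majorized_conjugateP //; set A := [set x in e].
have sumA F : \sum_(i <- e) F i = \sum_(i in A) F i.
  by rewrite big_uniq //; apply: eq_bigl => i; rewrite inE.
split=> [[M Msym Msum] I sIe|dom].
  rewrite sumA; apply: (symmetric_min_sum Msym) => [i|].
    by rewrite inE -sumA; apply: Msum.
  by apply/subsetP => i /sIe; rewrite inE.
have cut : cut_condition A r.
  apply: min_cut_condition => I /subsetP sIA; rewrite -sumA.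
  by apply: dom => i /sIA; rewrite inE.
have [M Msym Msum] := cut_condition_symmetric cut.
by exists M => // i ie; rewrite sumA Msum ?inE.
Qed.

End Degrees.

(** * Matrices invariant under the symmetries of the square *)

Section Square.

Variable n : nat.
Implicit Types (A : 'M[bool]_n) (R S : n.-tuple nat).

(** The stabilizer of [A] is a group, so invariance need only be checked on the two generators. *)
Lemma A4P R S A : reflect
  [/\ forall i, \sum_(j < n) A i j = tnth R i,
      forall j, \sum_(i < n) A i j = tnth S j,
      forall i j, A i j = A j i &
      forall i j, A i (rev_ord j) = A i j]
  (A \in A4 R S).
Proof.
rewrite inE; apply: (iffP and3P) => [[/forallP rowA /forallP colA /forall_inP fixA]|].
  split=> [i|j|i j|i j]; [exact/eqP|exact/eqP| |].
    have /eqP/matrixP/(_ i j) : D4_act (cell_tr n) A == A.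
      by apply: fixA; rewrite mem_gen ?set21.
    by rewrite D4_act_tr mxE.
  have /eqP/matrixP/(_ i j) : D4_act (cell_refl n) A == A.
    by apply: fixA; rewrite mem_gen ?set22.
  by rewrite D4_act_refl mxE.
case=> rowA colA trA reflA; split; [by apply/forallP => i; apply/eqP| |].
  by apply/forallP => j; apply/eqP.
apply/forall_inP; pose stab := [set g | D4_act g A == A].
have stab_group : group_set stab.
  apply/group_setP; split=> [|g h]; rewrite !inE.
    by apply/eqP/matrixP => i j; rewrite mxE perm1.
  by move=> /eqP gA /eqP hA; rewrite D4_act_mul hA gA.
suff /subsetP sub : D4 n \subset Group stab_group by move=> g /sub; rewrite inE.
rewrite gen_subG subUset !sub1set !inE D4_act_tr D4_act_refl.
by apply/andP; split; apply/eqP/matrixP => i j; rewrite mxE.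
Qed.

(** The first half is kept as a sequence in ['I_n], so that it indexes matrices and vectors without
    casts. *)
Definition half_ord := take n./2 (enum 'I_n).

Lemma half_ord_uniq : uniq half_ord.
Proof. by rewrite take_uniq ?enum_uniq. Qed.

Lemma mem_half_ord (i : 'I_n) : (i \in half_ord) = (i < n./2).
Proof.
rewrite -(mem_map val_inj) map_take val_enum_ord take_iota mem_iota add0n.
by rewrite (minn_idPl _) //; lia.
Qed.

Lemma check_seqE R : check_seq R = [seq (tnth R i)./2 | i <- half_ord].
Proof. by rewrite /check_seq -[X in take _ X]map_tnth_enum -map_take -map_comp. Qed.

Lemma sum_fold (f : 'I_n -> nat) : (forall j, f (rev_ord j) = f j) ->
  \sum_j f j = (\sum_(j <- half_ord) f j).*2 + \sum_(j | rev_ord j == j) f j.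
Proof.
move=> f_rev; rewrite (big_uniq _ half_ord_uniq) (bigID (mem half_ord)) /=.
rewrite -addnn -addnA; congr (_ + _).
rewrite (bigID (fun j => rev_ord j \in half_ord)) /=; congr (_ + _).
  rewrite (reindex_inj rev_ord_inj) /=; apply: eq_big => j; last by rewrite f_rev.
  by rewrite !mem_half_ord /=; have := ltn_ord j; lia.
apply: eq_bigl => j; rewrite !mem_half_ord -val_eqE /=; have := ltn_ord j; lia.
Qed.

Lemma rev_ord_fixed_odd (c : 'I_n) : rev_ord c = c -> odd n.
Proof. by move/(congr1 val) => /=; have := ltn_ord c; lia. Qed.

Lemma sum_fixed_odd (c : 'I_n) (f : 'I_n -> nat) : rev_ord c = c ->
  \sum_(j | rev_ord j == j) f j = f c.
Proof.
move=> /(congr1 val) /= fixc; apply: big_pred1 => /= j.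
change ((n - j.+1 == j) = (val j == val c)) => /=.
by have := ltn_ord j; have := ltn_ord c; lia.
Qed.

Lemma sum_fixed_even (f : 'I_n -> nat) : ~~ odd n ->
  \sum_(j | rev_ord j == j) f j = 0.
Proof.
move=> n_even; apply: big_pred0 => j.
by apply: contraNF n_even => /eqP/rev_ord_fixed_odd.
Qed.

(** The middle position, the upper half of [n] counted from 1, is shifted by one because [nth]
    counts from 0. *)
Lemma nth_center R (c : 'I_n) : rev_ord c = c -> nth 0 R (uphalf n).-1 = tnth R c.
Proof.
move=> /(congr1 val) /= fixc; rewrite (tnth_nth 0); congr nth.
by have := ltn_ord c; lia.
Qed.

Lemma exists_center : odd n -> exists c : 'I_n, rev_ord c = c.
Proof.
move=> n_odd; have ltn : n./2 < n by lia.
by exists (Ordinal ltn); apply/val_inj => /=; lia.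
Qed.

Lemma count_odd R : count odd R = \sum_i odd (tnth R i).
Proof.
by rewrite -sum1_count big_mkcond big_tuple; apply: eq_bigr => i _; case: odd.
Qed.

Lemma A4_necessary R S A : A \in A4 R S ->
  [/\ R = S, palindromic R,
      (~~ odd n -> forall i : 'I_n, ~~ odd (tnth R i)) /\
      (odd n -> count odd R = nth 0 R (uphalf n).-1)
    & majorized (check_seq R) (conjugate_seq (check_seq R))].
Proof.
case/A4P=> rowA colA trA reflA.
have sumR i : tnth R i =
    (\sum_(j <- half_ord) A i j).*2 + \sum_(j | rev_ord j == j) A i j.
  by rewrite -rowA sum_fold // => j; rewrite reflA.
split.
- apply: eq_from_tnth => i; rewrite -rowA -colA.
  by apply: eq_bigr => j _; rewrite trA.
- by move=> i; rewrite -!rowA; apply: eq_bigr => j _; rewrite trA -reflA trA.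
- split=> [n_even i|n_odd].
    by rewrite sumR sum_fixed_even // addn0 odd_double.
  have [c fixc] := exists_center n_odd.
  rewrite (nth_center R fixc) count_odd -rowA; apply: eq_bigr => i _.
  (* The parity of [tnth R i] is the middle-column entry [A i c], and by symmetry these entries form
     the middle row. *)
  rewrite sumR (sum_fixed_odd _ fixc) oddD odd_double.
  by rewrite oddb trA.
rewrite check_seqE; apply/(symmetric_majorizedP _ half_ord_uniq).
exists (fun i j => A i j) => // i _.
(* With a middle contribution of at most 1, the left half of row [i] sums to the rounded-down half
   of [tnth R i]. *)
suff : \sum_(j | rev_ord j == j) A i j <= 1 by rewrite sumR; lia.
case: (boolP (odd n)) => [/exists_center[c fixc]|n_even].
  by rewrite (sum_fixed_odd _ fixc); case: (A i c).
by rewrite sum_fixed_even.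
Qed.

Lemma A4_sufficient R : palindromic R ->
    (~~ odd n -> forall i : 'I_n, ~~ odd (tnth R i)) ->
    (odd n -> count odd R = nth 0 R (uphalf n).-1) ->
    majorized (check_seq R) (conjugate_seq (check_seq R)) ->
  A4 R R != set0.
Proof.
move=> palR evenR oddR; rewrite check_seqE.
move/(symmetric_majorizedP _ half_ord_uniq) => [M Msym Msum].
(* [fold] sends an index to its mirror representative in the first half; the centre stays fixed. *)
pose fold (i : 'I_n) := if i \in half_ord then i else rev_ord i.
have fold_rev i : rev_ord i != i -> fold (rev_ord i) = fold i.
  rewrite -val_eqE /= => /eqP ifix; rewrite /fold !mem_half_ord rev_ordK /=.
  by have ltin := ltn_ord i; do 2![case: ltnP => ?] => //; lia.
have fold_half i : rev_ord i != i -> fold i \in half_ord.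
  rewrite -val_eqE /fold => /eqP ifix; case: ifPn => //.
  by rewrite !mem_half_ord; move: ifix => /=; have := ltn_ord i; lia.
have R_fold i : tnth R (fold i) = tnth R i.
  by rewrite /fold; case: ifP => // _; rewrite -palR.
pose A : 'M[bool]_n := (\matrix_(i, j)
  if rev_ord i == i then odd (tnth R j)
  else if rev_ord j == j then odd (tnth R i) else M (fold i) (fold j))%R.
have trA i j : A i j = A j i.
  rewrite !mxE; case: (eqVneq (rev_ord i) i) => [fixi|_]; last first.
    by case: eqVneq => // _; rewrite Msym.
  case: (eqVneq (rev_ord j) j) => // fixj.
  (* Both indices are fixed by the reflection, and there is only one centre. *)
  suff -> : i = j by [].
  apply/val_inj => /=; move: fixi fixj => /(congr1 val) /= fixi /(congr1 val) /= fixj.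
  by have := ltn_ord i; have := ltn_ord j; lia.
have reflA i j : A i (rev_ord j) = A i j.
  rewrite !mxE rev_ordK -palR (eq_sym j); case: ifP => // _.
  by case: eqVneq => // /fold_rev->.
have rowA i : \sum_j A i j = tnth R i.
  case: (eqVneq (rev_ord i) i) => fixi.
    (* The middle row lists the parities of [R], so its sum is right precisely by the condition on
       the number of odd components. *)
    rewrite -(nth_center R fixi) -oddR ?(rev_ord_fixed_odd fixi) // count_odd.
    by apply: eq_bigr => j _; rewrite mxE fixi eqxx.
  rewrite sum_fold => [|j]; last by rewrite reflA.
  have -> : \sum_(j <- half_ord) A i j = (tnth R i)./2.
    rewrite -(R_fold i) -(Msum _ (fold_half i fixi)) !big_seq.
    apply: eq_bigr => j jH; rewrite mxE (negPf fixi) {2}/fold jH.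
    rewrite ifN //; apply/eqP => /(congr1 val) /=.
    by move: jH; rewrite mem_half_ord; lia.
  rewrite (eq_bigr (fun=> nat_of_bool (odd (tnth R i)))) => [|j fixj]; last first.
    by rewrite mxE (negPf fixi) fixj.
  (* The two halves give twice [(tnth R i)./2]; the centre must supply the parity, which is 0 when
     [n] is even. *)
  rewrite -[RHS]odd_double_half addnC; congr (_ + _).
  case: (boolP (odd n)) => [/exists_center[c fixc]|n_even].
    by rewrite (sum_fixed_odd _ fixc).
  by rewrite sum_fixed_even // (negPf (evenR n_even i)).
apply/set0Pn; exists A; apply/A4P; split=> // j.
by rewrite -rowA; apply: eq_bigr => i _; rewrite trA.
Qed.

End Square.

Theorem theorem19 (n : nat) (R S : n.-tuple nat)
  (hn : 1 <= n)
  (hR : forall i : 'I_n, tnth R i <= n)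
  (hS : forall j : 'I_n, tnth S j <= n)
  (hsum : \sum_(i < n) tnth R i = \sum_(j < n) tnth S j) :
  A4 R S != set0 <->
  [/\ R = S,
      palindromic R,
      (~~ odd n -> forall i : 'I_n, ~~ odd (tnth R i)) /\
      (odd n -> count odd R = nth 0 R (uphalf n).-1)
    & majorized (check_seq R) (conjugate_seq (check_seq R))].
Proof.
split=> [/set0Pn[A]|[<- palR [evenR oddR] maj]]; first exact: A4_necessary.
exact: A4_sufficient.
Qed.
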